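(* The following are equivalent: (1) there exists a countable discrete group $G$ such that the space $\Gamma_{\mathcal{U}}$ uniformly embeds in $G$; (2) for each uniformly discrete bounded geometry metric space $X$ there is a countable discrete group $G_X$ such that $X$ uniformly embeds in $G_X$; (3) there exists a countable discrete group $G$ such that every uniformly discrete bounded geometry metric space $X$ uniformly embeds in $G$.
   Context: $\Gamma_{\mathcal{U}}$ denotes the disjoint union of all connected finite graphs (up to isomorphism) in which every vertex lies in at most three edges, equipped with a metric such that: 1) its restriction to each graph is the standard edge (path-length) metric; 2) for all $R>0$, all but finitely many components $\Gamma$ of $\Gamma_{\mathcal{U}}$ have distance greater than $R$ from their complement in $\Gamma_{\mathcal{U}}$. This metric is unique up to coarse equivalence, and $\Gamma_{\mathcal{U}}$ is regarded (via vertex sets) as a uniformly discrete bounded geometry metric space. Countable discrete groups are equipped with a proper left-invariant metric (unique up to coarse equivalence). A metric space is uniformly discrete if the distances between distinct points are bounded below by a positive constant; it has bounded geometry if for every $R>0$ there is $N$ such that every ball $B_R(x)$ has at most $N$ points. A map $\phi\colon X\to Y$ of metric spaces is a uniform embedding if for all $R$ there exists $S$ such that $d(x,y)\le R$ implies $d(\phi(x),\phi(y))\le S$, and for all $R$ there exists $S$ such that $d(\phi(x),\phi(y))\le R$ implies $d(x,y)\le S$; $X$ uniformly embeds in $Y$ if such a $\phi$ exists. *)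

(* Defs.v *)
From HB Require Import structures.
From mathcomp Require Import all_boot all_order all_algebra generic_quotient.
From mathcomp Require Import all_classical all_reals all_analysis.

Set Implicit Arguments.
Unset Strict Implicit.
Unset Printing Implicit Defensive.

Import Order.TTheory GRing.Theory Num.Theory.

Local Open Scope classical_set_scope.
Local Open Scope ring_scope.

Section CoarseGeometry.
Context {R : realType}.

Definition uniformly_discrete (X : metricType R) : Prop :=
  exists2 e : R, 0 < e & forall x y : X, x <> y -> e <= mdist x y.

Definition bounded_geometry (X : metricType R) : Prop :=
  forall r : R, 0 < r -> exists N : nat, forall x : X, (ball x r #<= `I_N)%card.

Definition uniform_embedding (X Y : metricType R) (phi : X -> Y) : Prop :=
  (forall r : R, exists s : R, forall x y : X,
     mdist x y <= r -> mdist (phi x) (phi y) <= s) /\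
  (forall r : R, exists s : R, forall x y : X,
     mdist (phi x) (phi y) <= r -> mdist x y <= s).

Definition uniformly_embeds (X Y : metricType R) : Prop :=
  exists phi : X -> Y, uniform_embedding phi.

Definition set_dist (X : metricType R) (A B : set X) : \bar R :=
  ereal_inf [set (mdist x y)%:E | x in A & y in B].

End CoarseGeometry.

(* A group with a metric on its carrier; no compatibility is built in, see
   [left_invariant] below. *)
#[short(type="metricGroupType")]
HB.structure Definition MetricGroup (R : numDomainType) :=
  {G of Group G & Metric R G}.

Section Groups.
Context {R : realType}.

Definition left_invariant (G : metricGroupType R) : Prop :=
  forall g x y : G, mdist (g * x)%g (g * y)%g = mdist x y.

(* Compact subsets of a discrete space are finite, so a metric on a discrete
   group is proper when its closed balls are finite. Conversely, this
   finiteness forces the topology of the metric to be discrete. *)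
Definition proper_metric (G : metricGroupType R) : Prop :=
  forall (x : G) (r : R), finite_set [set y | mdist x y <= r].

Definition countable_discrete_group (G : metricGroupType R) : Prop :=
  [/\ countable [set: G], left_invariant G & proper_metric G].

End Groups.

Section PathMetric.
Context {T : finType} (e : rel T).

Definition walk (x y : T) (n : nat) : bool :=
  [exists p : n.-tuple T, path e x p && (last x p == y)].

Lemma connect_walk (x y : T) : connect e x y -> exists n, walk x y n.
Proof.
case/connectP => p ep ->; exists (size p).
by apply/existsP; exists (in_tuple p); rewrite ep eqxx.
Qed.

Definition path_metric (x y : T) (exy : connect e x y) : nat :=
  ex_minn (connect_walk exy).

End PathMetric.

(* Up to isomorphism the vertex set of a finite graph is some 'I_n; the second
   component is the adjacency relation. *)
Definition pregraph := {n : nat & {set 'I_n * 'I_n}}.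

Definition adj (g : pregraph) : rel 'I_(tag g) :=
  fun x y => (x, y) \in tagged g.

Definition connected_subcubic (g : pregraph) : bool :=
  [&& (0 < tag g)%N,
      [forall x, ~~ @adj g x x],
      [forall x, forall y, @adj g x y == @adj g y x],
      [forall x, #|[set y | @adj g x y]%SET| <= 3]%N &
      [forall x, forall y, connect (@adj g) x y]].

Definition graph := {g : pregraph | connected_subcubic g}.

Definition vertex (g : graph) : Type := 'I_(tag (val g)).

Definition edge (g : graph) : rel (vertex g) := @adj (val g).

Lemma graph_connected (g : graph) (x y : vertex g) : connect (@edge g) x y.
Proof. by case/and5P: (valP g) => _ _ _ _ /forallP/(_ x)/forallP/(_ y). Qed.

Definition gdist (g : graph) (x y : vertex g) : nat :=
  path_metric (graph_connected x y).

Definition graph_iso (g h : graph) : bool :=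
  `[< exists2 f : vertex g -> vertex h,
        bijective f & forall x y, edge (f x) (f y) = edge x y >].

Lemma graph_iso_refl : reflexive graph_iso.
Proof. by move=> g; apply/asboolP; exists id => //; exists id. Qed.

Lemma graph_iso_sym : symmetric graph_iso.
Proof.
suff H g h : graph_iso g h -> graph_iso h g by move=> g h; apply/idP/idP; apply: H.
move=> /asboolP[f [f' fK f'K] fe]; apply/asboolP; exists f'; first by exists f.
by move=> x y; rewrite -fe !f'K.
Qed.

Lemma graph_iso_trans : transitive graph_iso.
Proof.
move=> h g k /asboolP[f bf fe] /asboolP[f' bf' fe'].
apply/asboolP; exists (f' \o f); first exact: bij_comp.
by move=> x y /=; rewrite fe' fe.
Qed.

Canonical graph_iso_equiv :=
  EquivRel graph_iso graph_iso_refl graph_iso_sym graph_iso_trans.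

Definition component := {eq_quot graph_iso_equiv}%qT.

(* Vertex set of the disjoint union of one representative per isomorphism
   class. *)
Definition GammaU_vertex := {c : component & vertex (repr c)}.

Definition in_component (c : component) (x : vertex (repr c)) : GammaU_vertex :=
  Tagged (fun c => vertex (repr c)) x.

Section GammaU.
Context {R : realType} {Gamma : metricType R}.

(* [v] identifies the points of the metric space [Gamma] with the vertices of
   the disjoint union. *)
Definition component_set (v : GammaU_vertex -> Gamma) (c : component) :
    set Gamma :=
  range (fun x => v (@in_component c x)).

Definition is_GammaU (v : GammaU_vertex -> Gamma) : Prop :=
  [/\ bijective v,
      forall (c : component) (x y : vertex (repr c)),
        mdist (v (in_component x)) (v (in_component y)) = (gdist x y)%:R
    & forall r : R, 0 < r ->
        finite_set [set c | ~ (r%:E <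
          set_dist (component_set v c) (~` component_set v c))%E]].

End GammaU.

(* Main.v *)
Require Import Defs.
From HB Require Import structures.
From mathcomp Require Import all_boot all_order all_algebra generic_quotient.
From mathcomp Require Import finmap.
From mathcomp Require Import all_classical all_reals all_analysis.

Set Implicit Arguments.
Unset Strict Implicit.
Unset Printing Implicit Defensive.

Import Order.TTheory GRing.Theory Num.Theory.

Local Open Scope classical_set_scope.
Local Open Scope ring_scope.

(** Only one implication has content: a group [G] that contains a uniformly
embedded copy of [Gamma] contains a uniformly embedded copy of every space [X]
of bounded geometry ([universal_group]). This turns (1) into (3), and the
remaining implications hold because [Gamma] is itself uniformly discrete and of
bounded geometry ([GammaU_uniformly_discrete], [GammaU_bounded_geometry]).

The space [X] need not embed in [Gamma], whose components are finite, but its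
finite subsets do, with distortion bounds that depend on [X] alone
([finite_subset_controlled]). A finite subset [F] is encoded by a connected
cubic graph as follows. Bounded geometry lets each point [x] give every other
point [y] a private number [p x y], at least the distance of [x] and [y] and at
most a function of it ([bounded_geometry_code]). Attach to each [x] in [F] a
ray of vertices [(x, 0)], [(x, 1)], and so on, and join [(x, p x y)] to
[(y, p y x)] for [x <> y]. At most three edges meet at a vertex, since at most
one [y] has a given number at [x]. Close points have small numbers, so the feet
of their rays are close in the graph. Conversely, a short walk starting at the
foot of a ray cannot climb high, hence can only use edges between rays of
nearby points, and so it ends near its start ([ray_walk_drift]).

Composing with the embedding of [Gamma] gives maps from the finite subsets of
[X] to [G] with uniform bounds. By left invariance they may be assumed to send
a fixed base point to the identity; then each point of [X] has its images in
one ball of [G], a finite set because the metric is proper. The limit of these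
maps along an ultrafilter on the finite subsets is a map on all of [X] with the
same bounds ([controlled_ultralimit]). *)

(** * Walks in finite graphs *)

Section Walks.
Context {T : finType} (e : rel T).
Local Open Scope nat_scope.

Lemma walk0 x : walk e x x 0.
Proof. by apply/existsP; exists [tuple]; rewrite /= eqxx. Qed.

Lemma walk0_eq x y : walk e x y 0 -> x = y.
Proof. by case/existsP => p; rewrite tuple0 => /eqP. Qed.

Lemma walk_step x y z n : e x y -> walk e y z n -> walk e x z n.+1.
Proof.
move=> exy /existsP[p pz]; apply/existsP; exists [tuple of y :: p].
by rewrite /= exy.
Qed.

Lemma walk_stepP x z n :
  reflect (exists2 y, e x y & walk e y z n) (walk e x z n.+1).
Proof.
apply: (iffP idP) => [/existsP[p]|[y]]; last exact: walk_step.
case/tupleP: p => y p /= /andP[/andP[exy py] yz].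
by exists y => //; apply/existsP; exists p; rewrite py.
Qed.

Lemma walk1 x y : e x y -> walk e x y 1.
Proof. by move=> exy; apply: walk_step exy (walk0 y). Qed.

Lemma walk_cat x y z m n : walk e x y m -> walk e y z n -> walk e x z (m + n).
Proof.
elim: m x => [|m IHm] x; first by move=> /walk0_eq ->.
by move=> /walk_stepP[t xt ty] yz; apply: walk_step xt _; apply: IHm.
Qed.

Lemma walk_sym x y n : symmetric e -> walk e x y n -> walk e y x n.
Proof.
move=> es; elim: n x => [|n IHn] x; first by move=> /walk0_eq ->; exact: walk0.
move=> /walk_stepP[z xz zy]; rewrite -addn1.
by apply: walk_cat (IHn _ zy) (walk1 _); rewrite es.
Qed.

Lemma walk_connect x y n : walk e x y n -> connect e x y.
Proof. by case/existsP => p /andP[ep /eqP <-]; apply/connectP; exists p. Qed.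

Lemma path_metric_walk x y (exy : connect e x y) : walk e x y (path_metric exy).
Proof. by rewrite /path_metric; case: ex_minnP. Qed.

Lemma path_metric_le x y (exy : connect e x y) n :
  walk e x y n -> path_metric exy <= n.
Proof. by rewrite /path_metric; case: ex_minnP => m _; apply. Qed.

(** Growth in a graph of degree at most [d]: the ball of radius [n.+1] is
covered by the at most [d.+1] balls of radius [n] around the centre and its
neighbours. *)
Lemma card_walk_le d x n : (forall x, #|[set y | e x y]%SET| <= d) ->
  #|[set y | [exists m : 'I_n.+1, walk e x y m]]%SET| <= d.+1 ^ n.
Proof.
move=> ed; elim: n x => [|n IHn] x.
  rewrite expn0 (leq_trans _ (eq_leq (cards1 x)))// subset_leq_card//.
  apply/fintype.subsetP => y; rewrite !inE => /existsP[[[|]]]// _ /walk0_eq ->.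
  by rewrite eqxx.
pose N := (x |: [set y | e x y])%SET.
apply: (@leq_trans #|finset.cover [set [set y | [exists m : 'I_n.+1, walk e z y m]] | z in N]%SET|).
  apply/subset_leq_card/fintype.subsetP => y; rewrite !inE => /existsP[[[|m] mn] /= xy].
    apply/finset.bigcupP; exists [set y | [exists m : 'I_n.+1, walk e x y m]]%SET.
      by apply: imset_f; rewrite !inE eqxx.
    by rewrite inE; apply/existsP; exists ord0.
  case/walk_stepP: xy => z xz zy.
  apply/finset.bigcupP; exists [set y | [exists m : 'I_n.+1, walk e z y m]]%SET.
    by apply: imset_f; rewrite !inE xz orbT.
  by rewrite inE; apply/existsP; exists (Ordinal (mn : m < n.+1)).
rewrite (leq_trans (leq_card_cover _).1)//.
apply: leq_trans (_ : \sum_(A in [set [set y | [exists m : 'I_n.+1, walk e z y m]] | z in N]%SET) d.+1 ^ n <= _).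
  by apply: leq_sum => A /imsetP[z _ ->]; exact: IHn.
rewrite sum_nat_const expnS leq_mul2r (leq_trans (leq_imset_card _ _)) ?orbT//.
by rewrite (leq_trans (leq_card_setU _ _).1)// cards1 ltnS ed.
Qed.

End Walks.

Lemma walk_morph (T U : finType) (e : rel T) (e' : rel U) (f : T -> U) x y n :
  (forall x y, e x y -> e' (f x) (f y)) -> walk e x y n -> walk e' (f x) (f y) n.
Proof.
move=> fe; elim: n x => [|n IHn] x; first by move=> /walk0_eq ->; exact: walk0.
by move=> /walk_stepP[z xz zy]; apply: walk_step (IHn _ zy); exact: fe.
Qed.

Lemma walk_iso (T U : finType) (e : rel T) (e' : rel U) (f : T -> U) x y n :
  bijective f -> (forall x y, e' (f x) (f y) = e x y) ->
  walk e' (f x) (f y) n = walk e x y n.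
Proof.
move=> [g fK gK] fe; apply/idP/idP; last by apply: walk_morph => ? ?; rewrite fe.
rewrite -{2}(fK x) -{2}(fK y); apply: walk_morph => a b.
by rewrite -{1}(gK a) -{1}(gK b) fe.
Qed.

(** Walk counts are what the component must preserve: they determine the path
metric, and they pass through the enumeration of [T] and through the
isomorphism to the chosen representative alike. *)
Lemma component_of_graph (T : finType) (e : rel T) :
  T -> irreflexive e -> symmetric e ->
  (forall x, #|[set y | e x y]%SET| <= 3)%N ->
  (forall x y, connect e x y) ->
  exists (c : component) (h : T -> vertex (repr c)),
    forall x y n, walk (@edge (repr c)) (h x) (h y) n = walk e x y n.
Proof.
move=> x0 eirr esym edeg econ.
pose p : pregraph := existT (fun n => {set 'I_n * 'I_n}) #|T|
  [set ij | e (enum_val ij.1) (enum_val ij.2)]%SET.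
have padj i j : @adj p i j = e (enum_val i) (enum_val j) by rewrite /adj /= inE.
have radj x y : @adj p (enum_rank x) (enum_rank y) = e x y.
  by rewrite padj !enum_rankK.
have pc : connected_subcubic p.
  apply/and5P; split.
  - by apply/card_gt0P; exists x0.
  - by apply/forallP => i; rewrite padj eirr.
  - by apply/forallP => i; apply/forallP => j; rewrite !padj esym.
  - apply/forallP => i; rewrite (leq_trans _ (edeg (enum_val i)))//.
    rewrite -(card_imset _ enum_val_inj) subset_leq_card//.
    by apply/fintype.subsetP => _ /imsetP[j + ->]; rewrite !inE padj.
  - apply/forallP => i; apply/forallP => j.
    have [n] := connect_walk (econ (enum_val i) (enum_val j)).
    rewrite -(@walk_iso _ _ e (@adj p) _ _ _ n (enum_rank_bij T) radj) !enum_valK.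
    exact: walk_connect.
pose g : graph := exist _ p pc.
have /asboolP[f fbij fe] : graph_iso g (repr (\pi_component g)%qT).
  by rewrite graph_iso_sym; apply/eqmodP; rewrite reprK.
exists (\pi_component g)%qT, (f \o enum_rank) => x y n.
apply: walk_iso; first exact: bij_comp fbij (enum_rank_bij _).
by move=> a b /=; rewrite fe; exact: radj.
Qed.

(** * The cubic graph of rays over a finite set *)

Section RayGraph.
Context {V : finType} (p : V -> V -> nat) (K : nat).
Local Open Scope nat_scope.

(** The rays are cut at the common height [K], which is to bound [p] in order
that all the rungs between distinct rays are present. *)
Definition ray_adj : rel (V * 'I_K.+1) := fun a b =>
  if a.1 == b.1 then (a.2.+1 == b.2 :> nat) || (b.2.+1 == a.2 :> nat)
  else (a.2 == p a.1 b.1 :> nat) && (b.2 == p b.1 a.1 :> nat).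

Lemma ray_adj_irr : irreflexive ray_adj.
Proof. by move=> [x k]; rewrite /ray_adj /= eqxx orbb gtn_eqF. Qed.

Lemma ray_adj_sym : symmetric ray_adj.
Proof.
move=> [x k] [y l]; rewrite /ray_adj /= eq_sym.
by case: eqP => _; [rewrite orbC | rewrite andbC].
Qed.

(** The neighbours of [(x, k)] are those above and below it on the ray, and the
end of a rung that leaves the ray of [x] at height [k]; injectivity of [p x]
allows only one such rung. *)
Lemma ray_adj_deg a : (forall x, injective (p x)) ->
  #|[set b | ray_adj a b]%SET| <= 3.
Proof.
case: a => x k pI.
pose A (b : V * 'I_K.+1) := (x == b.1) && (k.+1 == b.2 :> nat).
pose B (b : V * 'I_K.+1) := (x == b.1) && (b.2.+1 == k :> nat).
pose C (b : V * 'I_K.+1) := (k == p x b.1 :> nat) && (b.2 == p b.1 x :> nat).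
have le1 (P : pred (V * 'I_K.+1)) :
    (forall b b', P b -> P b' -> b = b') -> #|finset P| <= 1.
  by move=> PI; apply/card_le1_eqP => b b'; rewrite !inE => Pb Pb'; exact: PI.
have sub : [set b | ray_adj (x, k) b]%SET \subset
    (finset A :|: finset B :|: finset C)%SET.
  apply/fintype.subsetP => -[y l]; rewrite !inE /ray_adj /A /B /C /=.
  by case: eqP => //= _ ->.
apply: leq_trans (subset_leq_card sub) _.
apply: leq_trans (leq_card_setU _ _).1 _.
rewrite (@leq_add _ _ 2 1)// ?(leq_trans (leq_card_setU _ _).1 (@leq_add _ _ 1 1 _ _))//.
- apply: le1 => -[y l] [z m] /andP[/= /eqP <- /eqP kl] /andP[/= /eqP <- /eqP km].
  by congr pair; apply: val_inj; rewrite /= -kl km.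
- apply: le1 => -[y l] [z m] /andP[/= /eqP <- /eqP kl] /andP[/= /eqP <- /eqP km].
  by congr pair; apply: val_inj; move: km; rewrite /= -kl => -[->].
apply: le1 => -[y l] [z m] /andP[/= /eqP kl /eqP ly] /andP[/= /eqP km /eqP mz].
have yz : y = z by apply: (pI x); rewrite -kl.
by rewrite -yz in mz *; congr pair; apply: val_inj; rewrite /= ly.
Qed.

Lemma ray_walk_climb x (k : 'I_K.+1) : walk ray_adj (x, ord0) (x, k) k.
Proof.
case: k => k; elim: k => [|k IHk] kK /=.
  by rewrite (_ : Ordinal kK = ord0); [exact: walk0 | exact: val_inj].
rewrite -[X in walk _ _ _ X]addn1; apply: walk_cat (IHk (ltnW kK)) (walk1 _).
by rewrite /ray_adj /= eqxx eqxx.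
Qed.

(** Climb the ray of [x] to the rung towards [y], cross it, and descend. *)
Lemma ray_walk x y : p x y <= K -> p y x <= K -> x != y ->
  walk ray_adj (x, ord0) (y, ord0) (p x y + (p y x).+1).
Proof.
move=> xyK yxK xy.
apply: walk_cat (ray_walk_climb x (Ordinal (xyK : p x y < K.+1))) _.
apply: (@walk_step _ _ _ (y, Ordinal (yxK : p y x < K.+1))).
  by rewrite /ray_adj /= (negbTE xy) !eqxx.
by apply: walk_sym ray_adj_sym _; exact: ray_walk_climb.
Qed.

Lemma ray_connect a b : (forall x y, p x y <= K) -> connect ray_adj a b.
Proof.
move=> pK; case: a b => [x k] [y l].
have base z m : connect ray_adj (z, ord0) (z, m).
  exact: walk_connect (ray_walk_climb z m).
apply: connect_trans (_ : connect _ _ (x, ord0)) _.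
  by rewrite (sym_connect_sym ray_adj_sym).
apply: connect_trans (base y l).
have [->|xy] := eqVneq x y; first exact: connect0.
exact: walk_connect (ray_walk (pK _ _) (pK _ _) xy).
Qed.

(** From height at most [k], a step covers a distance at most [k], since a rung
at that height joins points at most that far apart; it leads to height at most
[maxn k.+1 (rho k)]. Adding up the distances over [n] steps gives [drift]. *)
Fixpoint drift (rho : nat -> nat) n k :=
  if n is n'.+1 then k + drift rho n' (maxn k.+1 (rho k)) else 0.

End RayGraph.

Arguments ray_adj {V} p K _ _.

(** The bound does not involve [V], [f] or [K]: this is what makes the encoding
of all the finite subsets of a space uniform. *)
Lemma ray_walk_drift (R : realType) (X : metricType R) (V : finType) (f : V -> X)
    (p : V -> V -> nat) (rho : nat -> nat) (K : nat) :
  {homo rho : i j / (i <= j)%N} ->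
  (forall x y, mdist (f x) (f y) <= (p x y)%:R) ->
  (forall x y, (p y x <= rho (p x y))%N) ->
  forall n k0 x y (k l : 'I_K.+1), (k <= k0)%N ->
    walk (ray_adj p K) (x, k) (y, l) n -> mdist (f x) (f y) <= (drift rho n k0)%:R.
Proof.
move=> rhoM dp prho; elim=> [|n IHn] k0 x y k l kk0.
  by move=> /walk0_eq[-> _]; rewrite mdistxx.
case/walk_stepP => -[z m] xz zy.
have [dxz mk] : mdist (f x) (f z) <= k0%:R /\ (m <= maxn k0.+1 (rho k0))%N.
  move: xz; rewrite /ray_adj /=; case: eqP => [-> | _ /andP[/eqP kp /eqP mp]].
    rewrite mdistxx ler0n leq_max => /orP[] /eqP km; split=> //.
      by rewrite -km ltnS kk0.
    by rewrite ltnW// ltnS (leq_trans _ kk0)// -km leqnSn.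
  split; first by rewrite (le_trans (dp _ _))// ler_nat -kp.
  by rewrite mp leq_max; apply/orP; right; rewrite (leq_trans (prho x z))// rhoM// -kp.
rewrite /= natrD (le_trans (metric_triangle _ (f z) _))// lerD//.
exact: IHn mk zy.
Qed.

(** * Maps with prescribed control functions *)

Section Controlled.
Context {R : realType}.

(** A uniform embedding of [A] with its two control functions made explicit, so
that a family of maps can be required to share them. *)
Definition controlled (X Y : metricType R) (s t : R -> R) (A : set X)
    (phi : X -> Y) : Prop :=
  forall x y, A x -> A y -> forall r,
    (mdist x y <= r -> mdist (phi x) (phi y) <= s r) /\
    (mdist (phi x) (phi y) <= r -> mdist x y <= t r).

Lemma uniform_embeddingP (X Y : metricType R) (phi : X -> Y) :
  uniform_embedding phi <-> exists s t, controlled s t setT phi.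
Proof.
split=> [[/choice[s hs] /choice[t ht]]|[s [t h]]].
  by exists s, t => x y _ _ r; split; [exact: hs | exact: ht].
by split=> r; [exists (s r) | exists (t r)] => x y; have [] := h x y I I r.
Qed.

Lemma controlled_comp (X Y Z : metricType R) s t s' t' (A : set X)
    (phi : X -> Y) (psi : Y -> Z) :
  controlled s t A phi -> controlled s' t' setT psi ->
  controlled (s' \o s) (t \o t') A (psi \o phi).
Proof.
move=> hphi hpsi x y Ax Ay r; split=> [xy|].
  by have [+ _] := hpsi (phi x) (phi y) I I (s r); apply; have [+ _] := hphi x y Ax Ay r; exact.
move=> xy; have [_] := hphi x y Ax Ay (t' r); apply.
by have [_] := hpsi (phi x) (phi y) I I r; exact.
Qed.

End Controlled.

(** Let [D] be the integer part of the distance from [x] to [y]. The ball of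
radius [D + 1] around [x] contains [y] and has at most [N D] points; if [y] is
number [i] in it, put [p x y = 2 ^ D * (2 * i + 1)]. The pair [(D, i)]
determines [y] and is recovered from this product, which is at least [D + 1]
and is bounded in terms of [D]. *)
Lemma bounded_geometry_code (R : realType) (X : metricType R) :
  bounded_geometry X ->
  exists (p : X -> X -> nat) (rho : nat -> nat),
    [/\ forall x, injective (p x), {homo rho : i j / (i <= j)%N},
        forall x y, mdist x y <= (p x y)%:R &
        forall x y n, mdist x y <= n%:R -> (p x y <= rho n)%N].
Proof.
move=> Xbg.
have /choice[N hN] : forall n : nat, exists N, forall x : X,
    (ball x n.+1%:R #<= `I_N)%card by move=> n; exact: Xbg (ltr0Sn _ n).
have /choice[f hf] : forall xn : X * nat, exists f : X -> nat,
    set_inj (ball xn.1 xn.2.+1%:R) f /\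
    (forall y, ball xn.1 xn.2.+1%:R y -> f y < N xn.2)%N.
  move=> [x n]; have /pcard_leP[f] := hN n x.
  exists f; split; first exact: 'inj_f.
  by move=> y; exact: (@funS _ _ _ _ f).
pose D (x y : X) : nat := Num.truncn (mdist x y).
have DP x y : ball x (D x y).+1%:R y.
  by rewrite ballEmdist /= truncnS_gt.
pose p x y := (2 ^ D x y * (f (x, D x y) y).*2.+1)%N.
have logp x y : logn 2 (p x y) = D x y.
  rewrite /p lognM ?expn_gt0// pfactorK// logn_coprime ?addn0//.
  by rewrite coprime2n /= odd_double.
exists p, (fun n => \max_(i < n.+1) (2 ^ i * (N i).*2.+1))%N; split.
- move=> x y z pyz; have Dyz : D x y = D x z by rewrite -!logp pyz.
  move: pyz; rewrite /p Dyz => /eqP; rewrite eqn_pmul2l ?expn_gt0//.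
  rewrite eqSS => /eqP/double_inj.
  have [+ _] := hf (x, D x z); apply; rewrite inE; last exact: DP.
  by rewrite /= -Dyz; exact: DP.
- move=> i j ij; apply/bigmax_leqP => k _.
  exact: (@leq_bigmax _ (fun k : 'I_j.+1 => 2 ^ k * (N k).*2.+1)%N
    (widen_ord (ij : (i.+1 <= j.+1)%N) k)).
- move=> x y; have := DP x y; rewrite ballEmdist /= => /ltW/le_trans; apply.
  rewrite ler_nat /p mulnS (leq_trans (ltn_expl (D x y) (ltnSn 1)))//.
  exact: leq_addr.
- move=> x y n xyn; have Dn : (D x y < n.+1)%N.
    by rewrite ltnS /D truncn_le_nat (le_lt_trans xyn)// ltr_nat.
  apply: leq_trans (@leq_bigmax _ (fun k : 'I_n.+1 => 2 ^ k * (N k).*2.+1)%N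
    (Ordinal Dn)); rewrite /p leq_mul2l ltnS leq_double.
  have [_ /(_ y (DP x y)) /ltnW ->] := hf (x, D x y).
  by rewrite orbT.
Qed.

(** * The space of all cubic graphs *)

Lemma le_truncnS (R : realType) (x : R) : x <= (Num.truncn x).+1%:R.
Proof. by rewrite ltW// truncnS_gt. Qed.

Lemma positive_lower_bound (R : realType) (T : eqType) (s : seq T) (f : T -> R) :
  (forall x, x \in s -> 0 < f x) ->
  exists2 e, 0 < e & forall x, x \in s -> e <= f x.
Proof.
elim: s => [|y s IHs] fs; first by exists 1.
have [x xs|e e0 es] := IHs; first by apply: fs; rewrite inE xs orbT.
exists (Num.min (f y) e) => [|x]; first by rewrite lt_min e0 fs ?mem_head.
by rewrite inE ge_min => /orP[/eqP->|/es->]; rewrite ?lexx ?orbT.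
Qed.

Lemma card_le_seq (T : eqType) (A : set T) (s : seq T) n :
  A `<=` [set` s] -> (size s <= n)%N -> (A #<= `I_n)%card.
Proof.
move=> As sn; apply: card_le_trans (subset_card_le As) _.
case: s sn {As} => [_|x s sn].
  by rewrite set_nil; exact: card_ge0.
apply: (@card_le_trans _ _ _ `I_(size (x :: s))); last by rewrite card_le_II.
apply: card_le_trans (card_image_le (nth x (x :: s)) _).
apply: subset_card_le => y /= ys; exists (index y (x :: s)).
  by rewrite -index_mem in ys.
exact: nth_index.
Qed.

Section GammaU.
Context {R : realType} {Gamma : metricType R} {v : GammaU_vertex -> Gamma}.
Context (hGamma : is_GammaU v).

(** Each point goes to the foot of its ray, inside the component of [Gamma]
isomorphic to the graph of rays over [F]. The base point [x0] makes [F]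
nonempty, as the vertex set of a component must be. *)
Lemma finite_subset_controlled (X : metricType R) (x0 : X) :
  bounded_geometry X ->
  exists s t : R -> R, forall F : {fset X}, x0 \in F ->
    exists f : X -> Gamma, controlled s t [set` F] f.
Proof.
have [_ vd _] := hGamma => /bounded_geometry_code[p [rho [pI rhoM dp prho]]].
exists (fun r => (rho (Num.truncn r).+1 + (rho (Num.truncn r).+1).+1)%:R).
exists (fun r => (\max_(i < (Num.truncn r).+1) drift rho i 0)%:R).
move=> F x0F.
pose pF (u w : F) := p (val u) (val w).
have pFI u : injective (pF u) by move=> w w' /pI/val_inj.
pose K := \max_(uw : F * F) pF uw.1 uw.2.
have pK u w : (pF u w <= K)%N.
  exact: (@leq_bigmax _ (fun uw : F * F => pF uw.1 uw.2) (u, w)).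
have [] := @component_of_graph _ (ray_adj pF K) ([` x0F]%fset, ord0).
- exact: ray_adj_irr.
- exact: ray_adj_sym.
- by move=> a; exact: ray_adj_deg.
- by move=> a b; exact: ray_connect.
move=> c [h hw].
pose g (x : X) : F * 'I_K.+1 := (insubd [` x0F]%fset x, ord0).
have gK x : x \in F -> val (g x).1 = x by move=> xF; rewrite insubdK.
exists (fun x => v (in_component (h (g x)))) => x y xF yF r.
rewrite vd; split=> [xyr|hxyr].
  rewrite ler_nat; have [->|xy] := eqVneq x y.
    by rewrite (leq_trans (path_metric_le _ (walk0 _ _))).
  have xyn := le_trans xyr (le_truncnS r).
  have gxy : (g x).1 != (g y).1.
    by apply: contra_neq xy => gxy; rewrite -(gK x)// gxy gK.
  have wk := ray_walk (pK _ _) (pK _ _) gxy.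
  rewrite -hw in wk; apply: leq_trans (path_metric_le _ wk) _.
  rewrite /pF !gK// leq_add// ?ltnS; apply: prho => //.
  by rewrite metric_sym.
have := path_metric_walk (graph_connected (h (g x)) (h (g y))).
rewrite hw => /(@ray_walk_drift _ X _ val pF rho).
move=> /(_ rhoM (fun _ _ => dp _ _)).
(* The height after a jump is bounded through the height before it, which
   bounds the distance jumped. *)
have prF (u w : F) : (pF w u <= rho (pF u w))%N.
  by apply: prho; rewrite metric_sym; exact: dp.
move=> /(_ prF 0 (leqnn 0)); rewrite !gK// => /le_trans; apply.
rewrite ler_nat; set n := path_metric _.
have nr : (n < (Num.truncn r).+1)%N.
  by rewrite -(ltr_nat R) (le_lt_trans hxyr)// truncnS_gt.
exact: (@leq_bigmax _ (fun i : 'I_(Num.truncn r).+1 => drift rho i 0) (Ordinal nr)).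
Qed.

(** * Uniform discreteness and bounded geometry *)

Definition isolated (r : R) (c : component) : Prop :=
  (r%:E < set_dist (component_set v c) (~` component_set v c))%E.

Lemma isolated_close r c (x : vertex (repr c)) b : isolated r c ->
  mdist (v (in_component x)) (v b) <= r ->
  exists y : vertex (repr c), b = in_component y.
Proof.
move=> /[swap] xb; have [[v' vK _] _ _] := hGamma.
apply: contraPP => nb; apply/negP; rewrite -leNgt.
apply: (@le_trans _ _ (mdist (v (in_component x)) (v b))%:E); last by rewrite lee_fin.
apply: ereal_inf_lbound; exists (v (in_component x)); first by exists x.
by exists (v b) => // -[y _ /(can_inj vK) yb]; apply: nb; exists y.
Qed.

Lemma not_isolated_finite r : 0 < r ->
  exists s : seq GammaU_vertex, forall a, ~ isolated r (tag a) -> a \in s.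
Proof.
move=> r0; have [_ _ /(_ r r0)/finite_seqP[cs csE]] := hGamma.
exists (flatten [seq [seq @in_component c x | x <- enum 'I_(tag (val (repr c)))] | c <- cs]).
case=> c x /= nc; apply/flatten_mapP; exists c.
  by have : [set` cs] c by rewrite -csE.
by apply/mapP; exists x => //; rewrite mem_enum.
Qed.

(** Two distinct points at distance less than one lie in different components,
as the path metric is integral; both components fail to be isolated at scale
one, so only finitely many such pairs exist. *)
Lemma GammaU_uniformly_discrete : uniformly_discrete Gamma.
Proof.
have [[v' vK v'K] vd _] := hGamma.
have [s hs] := not_isolated_finite ltr01.
pose I := [seq ab <- [seq (a, b) | a <- s, b <- s] | ab.1 != ab.2].
have [|e e0 es] := @positive_lower_bound R _ I (fun ab => mdist (v ab.1) (v ab.2)).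
  by move=> ab; rewrite mem_filter mdist_gt0 (can_eq vK) => /andP[].
exists (Num.min 1 e); first by rewrite lt_min ltr01.
move=> x y xy; rewrite ge_min; case: leP => //= xy1.
rewrite -(v'K x) -(v'K y) in xy1 *.
have {}xy : v' x != v' y by apply/eqP => /(can_inj v'K).
have closeS a b : a != b -> mdist (v a) (v b) < 1 -> a \in s.
  move=> ab ab1; apply: hs; case: a ab ab1 => c a ab ab1 /= ic.
  have [b' bb'] := isolated_close ic (ltW ab1).
  move: ab1 ab; rewrite bb' (vd c) ltrn1 ltnS leqn0 => /eqP ab0.
  have := path_metric_walk (graph_connected a b'); rewrite -/(gdist a b') ab0.
  by move=> /walk0_eq ->; rewrite eqxx.
apply: (es (v' x, v' y)); rewrite mem_filter xy allpairs_f//.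
  exact: closeS xy xy1.
by apply: (closeS _ (v' x)); rewrite 1?eq_sym 1?metric_sym.
Qed.

(** A ball of radius [r] around a point of an isolated component stays in the
component, where the degree bounds its size; a ball around any other point
meets only the finitely many components that are not isolated. *)
Lemma GammaU_bounded_geometry : bounded_geometry Gamma.
Proof.
have [[v' vK v'K] vd _] := hGamma.
move=> r r0; have [s hs] := not_isolated_finite r0.
pose n := (Num.truncn r).+1.
exists (maxn (size s) (4 ^ n)) => x; rewrite -(v'K x).
case: (v' x) => c a.
have [ic|nc] := pselect (isolated r c).
  pose N := [set y | [exists m : 'I_n.+1, walk (@edge (repr c)) a y m]]%SET.
  apply: (@card_le_seq _ _ [seq v (@in_component c b) | b <- enum N]).
    move=> y; rewrite ballEmdist /= -(v'K y) => ayr.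
    have [b bE] := isolated_close ic (ltW ayr).
    rewrite bE (vd c) in ayr *; apply/mapP; exists b => //.
    rewrite mem_enum inE; apply/existsP.
    have dn : (gdist a b < n.+1)%N.
      by rewrite ltnS ltnW// -(ltr_nat R) (lt_trans ayr)// truncnS_gt.
    exists (Ordinal dn); exact: path_metric_walk.
  rewrite size_map -cardE leq_max; apply/orP; right; apply: card_walk_le => y.
  by case/and5P: (valP (repr c)) => _ _ _ /forallP/(_ y) + _; exact.
apply: (@card_le_seq _ _ [seq v b | b <- s]); last first.
  by rewrite size_map leq_max leqnn.
move=> y; rewrite ballEmdist /= -(v'K y) metric_sym => ayr.
apply: map_f; apply: hs; case: (v' y) ayr => d b ayr /= id.
have [a' aa'] := isolated_close id (ltW ayr).
by apply: nc; rewrite (_ : c = d)//; exact: (congr1 tag aa').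
Qed.

End GammaU.

(** * From finite subsets to the whole space *)

Lemma ultra_finite (T : Type) (U : eqType) (G : set_system T) (h : T -> U) (B : set U) :
  UltraFilter G -> finite_set B -> G (h @^-1` B) ->
  exists g, G (h @^-1` [set g]).
Proof.
move=> GU /finite_seqP[s ->]; elim: s => [|g s IHs] Gs.
  by have [x] := @filter_ex _ G _ _ Gs.
have [Gg|Gg] := in_ultra_setVsetC (h @^-1` [set g]) GU; first by exists g.
apply: IHs; apply: filterS (filterI Gs Gg) => x /= [].
by rewrite inE => /orP[/eqP|].
Qed.

(** Homogeneity of the group is what allows this passage to the limit: in a space
with few isometries the finite pieces could escape to infinity, as they do in
the disjoint union of the cubic graphs. *)
Lemma controlled_ultralimit (R : realType) (X : metricType R)
    (G : metricGroupType R) (s t : R -> R) (x0 : X) :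
  countable_discrete_group G ->
  (forall F : {fset X}, x0 \in F ->
    exists f : X -> G, controlled s t [set` F] f) ->
  exists phi : X -> G, controlled s t setT phi.
Proof.
move=> [_ Ginv Gproper] hF.
have /choice[f hf] : forall F : {fset X}, exists f : X -> G,
    x0 \in F -> f x0 = 1%g /\ controlled s t [set` F] f.
  move=> F; have [x0F|] := boolP (x0 \in F); last by exists (fun=> 1%g).
  have [f hf] := hF F x0F; exists (fun x => (f x0)^-1 * f x)%g => _.
  rewrite mulVg; split=> // x y xF yF r; rewrite Ginv; exact: hf.
(* [B] is the filter of finite subsets that contain a given finite subset. *)
pose B := filter_from [set: {fset X}] (fun A => [set F | (A `<=` F)%fset]).
have BF : ProperFilter B.
  apply: filter_from_proper => [|A _]; last by exists A => /=.
  apply: filter_fromT_filter; first by exists fset0.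
  move=> A A'; exists (A `|` A')%fset => F /=.
  by rewrite fsubUset => /andP[].
have [U [UU BU]] := ultraFilterLemma BF.
have UA (A : {fset X}) : U [set F | (A `<=` F)%fset] by apply: BU; exists A.
have /choice[phi hphi] : forall x, exists g, U [set F | f F x = g].
  move=> x; apply: (@ultra_finite _ _ U (fun F => f F x) _ UU
    (Gproper 1%g (s (mdist x0 x)))).
  apply: filterS (UA [fset x0; x]%fset) => F /=.
  rewrite fsubUset !fsub1set => /andP[x0F xF].
  have [<- hc] := hf F x0F.
  by have [+ _] := hc x0 x x0F xF (mdist x0 x); exact.
exists phi => x y _ _ r.
have [F [[<- <-]] /=] := @filter_ex _ U _ _
  (filterI (filterI (hphi x) (hphi y)) (UA [fset x0; x; y]%fset)).
rewrite !fsubUset !fsub1set => /andP[/andP[x0F xF] yF].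
by have [_] := hf F x0F; apply.
Qed.

(** The group is the same for all [X], although the bounds for the finite subsets
depend on [X]. *)
Lemma universal_group (R : realType) (Gamma : metricType R)
    (v : GammaU_vertex -> Gamma) (G : metricGroupType R) :
  is_GammaU v -> countable_discrete_group G -> uniformly_embeds Gamma G ->
  forall X : metricType R, bounded_geometry X -> uniformly_embeds X G.
Proof.
move=> hv hG [psi /uniform_embeddingP[s' [t' hpsi]]] X Xbg.
have [[x0]|X0] := pselect (inhabited X); last first.
  by exists (fun=> 1%g); split=> r; exists 0 => x; case: X0.
have [s [t hF]] := finite_subset_controlled hv x0 Xbg.
have [|phi hphi] := @controlled_ultralimit _ X G (s' \o s) (t \o t') x0 hG.
  move=> F /hF[f hf]; exists (psi \o f); exact: controlled_comp hf hpsi.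
by exists phi; apply/uniform_embeddingP; exists (s' \o s), (t \o t').
Qed.

Theorem theorem25 (R : realType) (Gamma : metricType R)
    (v : GammaU_vertex -> Gamma) (hGamma : is_GammaU v) :
  [<-> exists G : metricGroupType R,
         countable_discrete_group G /\ uniformly_embeds Gamma G;
       forall X : metricType R, uniformly_discrete X -> bounded_geometry X ->
         exists G : metricGroupType R,
           countable_discrete_group G /\ uniformly_embeds X G;
       exists G : metricGroupType R,
         countable_discrete_group G /\
         forall X : metricType R, uniformly_discrete X -> bounded_geometry X ->
           uniformly_embeds X G].
Proof.
have Gud := GammaU_uniformly_discrete hGamma.
have Gbg := GammaU_bounded_geometry hGamma.
tfae.
- move=> [G [hG GammaG]] X _ Xbg; exists G; split=> //.
  exact: universal_group hGamma hG GammaG X Xbg.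
- move=> /(_ Gamma Gud Gbg)[G [hG GammaG]]; exists G; split=> // X _.
  exact: universal_group hGamma hG GammaG X.
- by move=> [G [hG GX]]; exists G; split=> //; exact: GX.
Qed.
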